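(* Let $M\geq 2$ be an integer. Consider all pairs $(X,Y)$ where $X$ is a random variable with values in $\{1,\ldots,M\}$ and $Y$ is an arbitrary random variable (side information). (1) The optimal lower bound on the conditional guessing entropy $G(X|Y)$ in terms of the conditional Shannon entropy $H(X|Y)$ is given by the parametric curve, $\gamma\in(0,1)$, $$G(\gamma)=\frac{1}{1-\gamma}-\frac{M\gamma^M}{1-\gamma^M},\qquad H(\gamma)=\log\Bigl(\gamma\,\frac{1-\gamma^M}{1-\gamma}\Bigr)-(\log\gamma)\Bigl(\frac{1}{1-\gamma}-\frac{M\gamma^M}{1-\gamma^M}\Bigr).$$ That is: (i) for every $(X,Y)$ and every $\gamma\in(0,1)$ with $H(X|Y)=H(\gamma)$, one has $G(X|Y)\geq G(\gamma)$; (ii) for every $\gamma\in(0,1)$ there is a pair $(X,Y)$ with $H(X|Y)=H(\gamma)$ and $G(X|Y)=G(\gamma)$; (iii) every value in $(0,\log M)$ is of the form $H(\gamma)$ for some $\gamma\in(0,1)$. In the limiting case $\gamma\to1$, one has $G(\gamma)\to\frac{M+1}{2}$ and $H(\gamma)\to\log M$, values which are attained for $X$ uniformly distributed. (2) Let $\Delta G(X;Y)=\frac{M+1}{2}-G(X|Y)$ and $\Delta H(X;Y)=\log M-H(X|Y)$. The optimal upper bound on $\Delta G(X;Y)$ in terms of $\Delta H(X;Y)$ is given by the parametric curve, $\mu\in(0,+\infty)$, $$\Delta G(\mu)=\tfrac12\bigl(M\coth(M\mu)-\coth(\mu)\bigr),\qquad \Delta H(\mu)=\log\frac{M\sinh\mu}{\sinh(M\mu)}+2\mu(\log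 e)\,\Delta G(\mu).$$ That is: (i) for every $(X,Y)$ and every $\mu>0$ with $\Delta H(X;Y)=\Delta H(\mu)$, one has $\Delta G(X;Y)\leq\Delta G(\mu)$; (ii) for every $\mu>0$ there is a pair $(X,Y)$ attaining both values; (iii) every value in $(0,\log M)$ is of the form $\Delta H(\mu)$ for some $\mu>0$.
   Context: $\log$ is the logarithm to an arbitrary fixed base greater than $1$; $e$ is Euler's number. For a random variable $X$ with values in $\{1,\ldots,M\}$ and pmf $p_X$: the Shannon entropy is $H(X)=-\sum_{i} p_X(i)\log p_X(i)$ (with $0\log 0=0$), and the guessing entropy is $G(X)=\min_\sigma\sum_{i=1}^M p_X(\sigma(i))\,i$, the minimum being over all permutations $\sigma$ of $\{1,\ldots,M\}$. For an arbitrary (discrete or continuous) random variable $Y$, with $H(X|Y=y)$ and $G(X|Y=y)$ denoting these quantities computed for the conditional pmf $p_{X|Y=y}$, set $H(X|Y)=\mathbb{E}_y H(X|Y=y)$ and $G(X|Y)=\mathbb{E}_y G(X|Y=y)$, where the expectation is over the distribution of $Y$. *)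

(* Defs.v *)
From HB Require Import structures.
From mathcomp Require Import all_boot all_order all_algebra all_fingroup.
From mathcomp Require Import all_classical all_reals all_analysis.

Set Implicit Arguments.
Unset Strict Implicit.
Unset Printing Implicit Defensive.
Import Order.TTheory GRing.Theory Num.Theory.
Import numFieldNormedType.Exports.
Local Open Scope classical_set_scope.
Local Open Scope charge_scope.
Local Open Scope ring_scope.

Definition logb (R : realType) (b x : R) : R := ln x / ln b.

(* A pmf on {1, ..., M} is a function 'I_M -> R, the index i standing for the
   value i.+1. *)

(* [ln 0 = 0] in the library, and the factor [p i] vanishes anyway, so that
   0 log 0 = 0. *)
Definition shannon (R : realType) (b : R) (M : nat) (p : 'I_M -> R) : R :=
  - \sum_(i < M) p i * logb b (p i).

Definition guess_cost (R : realType) (M : nat) (p : 'I_M -> R) (s : 'S_M) : R :=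
  \sum_(i < M) p (s i) * i.+1%:R.

(* The default value of the big minimum is the cost of the identity, which is
   one of the terms, so this is the minimum over 'S_M. *)
Definition guessing (R : realType) (M : nat) (p : 'I_M -> R) : R :=
  \big[Num.min/guess_cost p 1%g]_(s : 'S_M) guess_cost p s.

Definition pmf_of (R : realType) (M : nat) d (Omega : measurableType d)
    (P : probability Omega R) (X : {RV P >-> nat}) (i : 'I_M) : R :=
  fine (P (X @^-1` [set i.+1])).

Section joint.
Context (R : realType) d (Omega : measurableType d) (P : probability Omega R).
Context d' (T : measurableType d').
Variables (X : {RV P >-> nat}) (Y : {RV P >-> T}) (n : nat).

Definition joint (B : set T) : \bar R :=
  P (Y @^-1` B `&` X @^-1` [set n]).

Let mX : measurable (X @^-1` [set n]).
Proof. by rewrite -[_ @^-1` _]setTI; exact: measurable_funPT. Qed.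

Let joint0 : joint set0 = 0%E.
Proof. exact: (measure0 (pushforward (mrestr P mX) Y)). Qed.

Let joint_ge0 B : (0 <= joint B)%E.
Proof. exact: (measure_ge0 (pushforward (mrestr P mX) Y)). Qed.

Let joint_sigma_additive : semi_sigma_additive joint.
Proof.
exact: (@measure_semi_sigma_additive _ _ _ (pushforward (mrestr P mX) Y)).
Qed.

HB.instance Definition _ := isMeasure.Build _ _ _ joint
  joint0 joint_ge0 joint_sigma_additive.

Let joint_fin : fin_num_fun joint.
Proof.
move=> B mB; apply: fin_num_measure; apply: measurableI => //.
by rewrite -[_ @^-1` _]setTI; exact: measurable_funPT.
Qed.

HB.instance Definition _ := Measure_isFinite.Build _ _ _ joint joint_fin.

End joint.

(* p_{X|Y=y}(i), for an arbitrary Y: the density at y of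
   B |-> P(Y in B, X = i) with respect to the distribution of Y. As usual it is
   determined, and is a pmf in i, only for almost all y. *)
Definition cond_pmf (R : realType) (M : nat) d (Omega : measurableType d)
    (P : probability Omega R) d' (T : measurableType d')
    (X : {RV P >-> nat}) (Y : {RV P >-> T}) (y : T) (i : 'I_M) : R :=
  fine (('d (charge_of_finite_measure (joint X Y i.+1))
           '/d (distribution P Y)) y).

Definition cond_shannon (R : realType) (b : R) (M : nat)
    d (Omega : measurableType d) (P : probability Omega R)
    d' (T : measurableType d') (X : {RV P >-> nat}) (Y : {RV P >-> T}) : R :=
  fine ('E_(distribution P Y)[fun y => shannon b (@cond_pmf R M _ _ P _ _ X Y y)]).

Definition cond_guessing (R : realType) (M : nat)
    d (Omega : measurableType d) (P : probability Omega R)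
    d' (T : measurableType d') (X : {RV P >-> nat}) (Y : {RV P >-> T}) : R :=
  fine ('E_(distribution P Y)[fun y => guessing (@cond_pmf R M _ _ P _ _ X Y y)]).

Definition DeltaG (R : realType) (M : nat)
    d (Omega : measurableType d) (P : probability Omega R)
    d' (T : measurableType d') (X : {RV P >-> nat}) (Y : {RV P >-> T}) : R :=
  M.+1%:R / 2 - cond_guessing M X Y.

Definition DeltaH (R : realType) (b : R) (M : nat)
    d (Omega : measurableType d) (P : probability Omega R)
    d' (T : measurableType d') (X : {RV P >-> nat}) (Y : {RV P >-> T}) : R :=
  logb b M%:R - cond_shannon b M X Y.

Definition Gcurve (R : realType) (M : nat) (g : R) : R :=
  1 / (1 - g) - M%:R * g ^+ M / (1 - g ^+ M).

Definition Hcurve (R : realType) (b : R) (M : nat) (g : R) : R :=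
  logb b (g * ((1 - g ^+ M) / (1 - g)))
  - logb b g * (1 / (1 - g) - M%:R * g ^+ M / (1 - g ^+ M)).

Definition sinh (R : realType) (x : R) : R := (expR x - expR (- x)) / 2.
Definition cosh (R : realType) (x : R) : R := (expR x + expR (- x)) / 2.
Definition coth (R : realType) (x : R) : R := cosh x / sinh x.

Definition DGcurve (R : realType) (M : nat) (mu : R) : R :=
  1 / 2 * (M%:R * coth (M%:R * mu) - coth mu).

Definition DHcurve (R : realType) (b : R) (M : nat) (mu : R) : R :=
  logb b (M%:R * sinh mu / sinh (M%:R * mu))
  + 2 * mu * logb b (expR 1) * DGcurve M mu.

(* Main.v *)
(* Gibbs' inequality against the geometric pmf q_g(i) = g ^ i / Z, taken after
   sorting the pmf p optimally, reads
     H(p) <= log Z - (log g) G(p),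
   with equality at p = q_g. As it is affine in (H, G), it survives averaging
   over Y, and dividing by - log g > 0 gives the lower bound on G(X|Y) at fixed
   H(X|Y). Equality is attained by X ~ q_g with constant Y. Every entropy in
   (0, log M) is reached by the intermediate value theorem, since H(g) extends
   continuously to log M at g = 1 and is O(sqrt g) near 0. Part (2) is part (1)
   in the parameter g = exp (- 2 mu). *)
Require Import Defs.
From HB Require Import structures.
From mathcomp Require Import all_boot all_order all_algebra all_fingroup.
From mathcomp Require Import all_classical all_reals all_analysis.
From mathcomp Require Import measurable_realfun ring lra.

Set Implicit Arguments.
Unset Strict Implicit.
Unset Printing Implicit Defensive.
Import Order.TTheory GRing.Theory Num.Theory.
Import numFieldNormedType.Exports.
Local Open Scope classical_set_scope.
Local Open Scope ring_scope.

(** * The geometric pmf and elementary bounds for pmfs *)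

Definition gibbsZ (R : realType) (M : nat) (g : R) : R :=
  \sum_(i < M) g ^+ i.+1.

Definition gibbsS (R : realType) (M : nat) (g : R) : R :=
  \sum_(i < M) g ^+ i.+1 * i.+1%:R.

Definition gibbs (R : realType) (M : nat) (g : R) (i : nat) : R :=
  g ^+ i.+1 / gibbsZ M g.

(** The entropy of the geometric pmf in nats. Finite sums replace the closed forms of the curve, so
    that [g = 1], the uniform pmf, needs no separate definition. *)
Definition gibbsH (R : realType) (M : nat) (g : R) : R :=
  ln (gibbsZ M g) - ln g * (gibbsS M g / gibbsZ M g).

Section pmf.
Variables (R : realType) (M : nat).
Implicit Types (p : 'I_M -> R) (g : R) (s : 'S_M).

Lemma guessing_le p s : guessing p <= guess_cost p s.
Proof. exact: bigmin_le_cond. Qed.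

Lemma guessing_attained p : exists s, guessing p = guess_cost p s.
Proof.
rewrite /guessing; elim/big_ind: _ => [|x y [s ->] [t ->]|s _].
- by exists 1%g.
- by case: (leP (guess_cost p s) (guess_cost p t)) => _; [exists s|exists t].
- by exists s.
Qed.

Lemma guessing_const p (c : R) : (forall i, p i = c) ->
  guessing p = guess_cost p 1%g.
Proof.
move=> pc; have [s ->] := guessing_attained p.
by apply: eq_bigr => i _; rewrite !pc.
Qed.

Lemma gibbsZ_gt0 g : (0 < M)%N -> 0 < g -> 0 < gibbsZ M g.
Proof.
case: M => // m _ g0; rewrite /gibbsZ big_ord_recl /=.
apply: ltr_wpDr; last by rewrite exprn_gt0.
by apply: sumr_ge0 => i _; rewrite exprn_ge0 // ltW.
Qed.

(** One term of Gibbs' inequality: [ln u <= u - 1] at [u = q / x], multiplied by [x]. The case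
    [x = 0] is separate, as [u] is then meaningless. *)
Lemma mul_ln_le (x q : R) : 0 <= x -> 0 < q -> x * ln q - x * ln x <= q - x.
Proof.
rewrite le_eqVlt => /orP[/eqP <- q0|x0 q0]; first by rewrite !mul0r !subr0 ltW.
rewrite -mulrBr -ln_div ?posrE//.
have qx : 0 < q / x by rewrite divr_gt0.
have /(ler_wpM2l (ltW x0)) : ln (q / x) <= q / x - 1.
  have := @le_ln1Dx R (q / x - 1); rewrite subrKC; apply; lra.
by rewrite mulrBr mulr1 mulrCA divff ?mulr1// gt_eqF.
Qed.

Lemma ln_gibbs g i : (0 < M)%N -> 0 < g ->
  ln (gibbs M g i) = i.+1%:R * ln g - ln (gibbsZ M g).
Proof.
move=> M0 g0; rewrite ln_div ?posrE ?exprn_gt0 ?gibbsZ_gt0//.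
by rewrite lnXn // mulr_natl.
Qed.

Lemma gibbs_gt0 g i : (0 < M)%N -> 0 < g -> 0 < gibbs M g i.
Proof. by move=> M0 g0; rewrite divr_gt0 ?exprn_gt0 ?gibbsZ_gt0. Qed.

Lemma sum_gibbs g : (0 < M)%N -> 0 < g -> \sum_(i < M) gibbs M g i = 1.
Proof.
by move=> M0 g0; rewrite -mulr_suml divff // gt_eqF // gibbsZ_gt0.
Qed.

Lemma guess_cost_gibbs g :
  guess_cost (fun i : 'I_M => gibbs M g i) 1%g = gibbsS M g / gibbsZ M g.
Proof.
rewrite /guess_cost /gibbsS mulr_suml; apply: eq_bigr => i _.
by rewrite perm1 /gibbs mulrAC.
Qed.

Lemma norm_mul_ln_le1 (x : R) : 0 <= x <= 1 -> `|x * ln x| <= 1.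
Proof.
move=> /andP[]; rewrite le_eqVlt => /orP[/eqP <-|x0 x1].
  by rewrite mul0r normr0.
rewrite normrM (gtr0_norm x0) ler0_norm ?ln_le0// -lnV ?posrE//.
rewrite -(divff (lt0r_neq0 x0)) ler_pM2l// ltW// ln_sublinear// invr_gt0//.
Qed.

Lemma pmf_le1 p i : (forall i, 0 <= p i) -> \sum_i p i = 1 -> p i <= 1.
Proof.
by move=> p0 <-; rewrite (bigD1 i)//= lerDl sumr_ge0.
Qed.

(** A crude uniform bound, used to make the conditional guessing entropy integrable. *)
Lemma norm_guessing_le p : (forall i, 0 <= p i) -> \sum_i p i = 1 ->
  `|guessing p| <= \sum_(i < M) i.+1%:R.
Proof.
move=> p0 p1; have [s ->] := guessing_attained p.
rewrite ger0_norm; last by apply: sumr_ge0 => i _; rewrite mulr_ge0.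
by apply: ler_sum => i _; rewrite ler_piMl// pmf_le1.
Qed.

End pmf.

(** * Gibbs' inequality against the geometric pmf *)

Section shannon.
Variables (R : realType) (b : R) (M : nat).
Hypothesis b_gt1 : 1 < b.
Implicit Types (p : 'I_M -> R) (g : R) (s : 'S_M).

Let lnb_gt0 : 0 < ln b. Proof. exact: ln_gt0. Qed.

Lemma shannonE p : shannon b p = - (\sum_(i < M) p i * ln (p i)) / ln b.
Proof.
rewrite /shannon /logb mulNr mulr_suml; congr (- _).
by apply: eq_bigr => i _; rewrite mulrA.
Qed.

(** Entropy is invariant under permutation, so Gibbs' inequality can be applied to [p] rearranged by
    any [s]. Since [ln (gibbs M g i)] is affine in [i.+1], the cross entropy is affine in the
    guessing cost. *)
Lemma shannon_le_cost p s g : (0 < M)%N -> 0 < g ->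
  (forall i, 0 <= p i) -> \sum_i p i = 1 ->
  shannon b p * ln b <= ln (gibbsZ M g) - ln g * guess_cost p s.
Proof.
move=> M0 g0 p0 p1; rewrite shannonE divfK ?gt_eqF//.
have ps1 : \sum_i p (s i) = 1 by rewrite -p1 [RHS](reindex_inj (@perm_inj _ s)).
rewrite (reindex_inj (@perm_inj _ s)) /=.
have : \sum_i (p (s i) * ln (gibbs M g i) - p (s i) * ln (p (s i)))
    <= \sum_(i < M) (gibbs M g i - p (s i)).
  by apply: ler_sum => i _; apply: mul_ln_le; rewrite ?gibbs_gt0.
rewrite !sumrB ps1 sum_gibbs// subrr.
under [X in X - _ <= _]eq_bigr do rewrite ln_gibbs// mulrBr.
rewrite sumrB -mulr_suml ps1 /guess_cost.
rewrite (eq_bigr (fun i : 'I_M => ln g * (p (s i) * i.+1%:R))); last first.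
  by move=> i _; ring.
rewrite -mulr_sumr; lra.
Qed.

Lemma shannon_le_guessing p g : (0 < M)%N -> 0 < g ->
  (forall i, 0 <= p i) -> \sum_i p i = 1 ->
  shannon b p * ln b <= ln (gibbsZ M g) - ln g * guessing p.
Proof.
move=> M0 g0 p0 p1; have [s ->] := guessing_attained p.
exact: shannon_le_cost.
Qed.

Lemma shannon_gibbs g : (0 < M)%N -> 0 < g ->
  shannon b (fun i : 'I_M => gibbs M g i) = gibbsH M g / ln b.
Proof.
move=> M0 g0; rewrite shannonE; congr (_ / _).
under [X in - X]eq_bigr do rewrite ln_gibbs// mulrBr.
rewrite sumrB -mulr_suml sum_gibbs// mul1r opprB; congr (_ - _).
rewrite -guess_cost_gibbs mulr_sumr; apply: eq_bigr => i _.
by rewrite perm1; ring.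
Qed.

Lemma norm_shannon_le p : (forall i, 0 <= p i) -> \sum_i p i = 1 ->
  `|shannon b p| <= M%:R / ln b.
Proof.
move=> p0 p1; rewrite shannonE normrM normrN normfV (gtr0_norm lnb_gt0).
rewrite ler_pM2r ?invr_gt0//; apply: (le_trans (ler_norm_sum _ _ _)).
rewrite -[leRHS](_ : \sum_(i < M) 1 = _); last by rewrite sumr_const card_ord.
by apply: ler_sum => i _; apply: norm_mul_ln_le1; rewrite p0 pmf_le1.
Qed.

End shannon.

Lemma guessing_gibbs (R : realType) (M : nat) (g : R) :
  (0 < M)%N -> 0 < g <= 1 ->
  guessing (fun i : 'I_M => gibbs M g i) = gibbsS M g / gibbsZ M g.
Proof.
move=> M0 /andP[g0]; rewrite le_eqVlt => /orP[/eqP ->|g1].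
  (* At [g = 1] the factor [ln g] vanishes and Gibbs' inequality says nothing about the cost; but
     the pmf is constant, so all permutations cost the same. *)
  rewrite (@guessing_const _ _ _ (1 / gibbsZ M 1)) ?guess_cost_gibbs//.
  by move=> i; rewrite /gibbs expr1n.
apply/eqP; rewrite eq_le -{1}guess_cost_gibbs guessing_le /=.
have p0 (i : 'I_M) : 0 <= gibbs M g i by rewrite ltW// gibbs_gt0.
(* Equality in [shannon_le_guessing] at the Gibbs pmf makes the identity
   permutation optimal. *)
have b1 : 1 < 2 :> R by rewrite ltr1n.
have := shannon_le_guessing b1 M0 g0 p0 (sum_gibbs M0 g0).
rewrite shannon_gibbs// divfK ?gt_eqF ?ln_gt0// /gibbsH.
by rewrite lerD2l lerN2 ler_nM2l // ln_lt0 // g0.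
Qed.

(** * The curve: closed forms, continuity, range of entropies *)

Section curve.
Variables (R : realType) (b : R) (M : nat).
Hypotheses (b_gt1 : 1 < b) (M_gt0 : (0 < M)%N).
Implicit Types (g : R).

Let lnb_gt0 : 0 < ln b. Proof. exact: ln_gt0. Qed.

Lemma gibbsZ_geom g : (1 - g) * gibbsZ M g = g * (1 - g ^+ M).
Proof.
rewrite /gibbsZ; elim: M => [|m IH]; first by rewrite big_ord0 expr0; ring.
by rewrite big_ord_recr /= mulrDr IH !exprS; ring.
Qed.

(** Summation by parts. Like [gibbsZ_geom], it is stated without division, which makes the induction
    on [M] purely polynomial. *)
Lemma gibbsS_geom g :
  (1 - g) * gibbsS M g = gibbsZ M g - M%:R * g ^+ M.+1.
Proof.
rewrite /gibbsZ /gibbsS; elim: M => [|m IH]; first by rewrite !big_ord0; ring.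
by rewrite !big_ord_recr /= mulrDr IH !exprS -natr1; ring.
Qed.

Lemma gibbsZE g : g != 1 -> gibbsZ M g = g * ((1 - g ^+ M) / (1 - g)).
Proof.
move=> g1; rewrite mulrA -gibbsZ_geom mulrAC divff ?mul1r//.
by rewrite subr_eq0 eq_sym.
Qed.

Lemma GcurveE g : 0 < g < 1 -> Gcurve M g = gibbsS M g / gibbsZ M g.
Proof.
move=> /andP[g0 g1]; have gM : 1 - g ^+ M != 0.
  by rewrite subr_eq0 eq_sym lt_eqF// exprn_ilt1 ?lt0n_neq0// ltW.
have gd : 1 - g != 0 by rewrite subr_eq0 eq_sym lt_eqF.
have Z0 : gibbsZ M g != 0 by rewrite gt_eqF ?gibbsZ_gt0.
rewrite -[gibbsS M g](mulKf gd) gibbsS_geom gibbsZE ?lt_eqF// /Gcurve exprS.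
by field; rewrite gM gd gt_eqF.
Qed.

Lemma HcurveE g : 0 < g < 1 -> Hcurve b M g = gibbsH M g / ln b.
Proof.
move=> /[dup] g01 /andP[g0 g1].
rewrite /Hcurve -/(Gcurve M g) GcurveE// -gibbsZE ?lt_eqF// /gibbsH /logb.
by ring.
Qed.

Lemma sum_succ : 2 * \sum_(i < M) i.+1%:R = M%:R * M.+1%:R :> R.
Proof.
elim: M => [|m IH]; first by rewrite big_ord0; ring.
by rewrite big_ord_recr /= mulrDr IH -!natr1; ring.
Qed.

Lemma gibbsZ1 : gibbsZ M 1 = M%:R :> R.
Proof.
rewrite /gibbsZ (eq_bigr (fun=> 1)) ?sumr_const ?card_ord//.
by move=> i _; rewrite expr1n.
Qed.

Lemma gibbsSZ1 : gibbsS M 1 / gibbsZ M 1 = M.+1%:R / 2 :> R.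
Proof.
rewrite gibbsZ1 /gibbsS; under eq_bigr do rewrite expr1n mul1r.
have M0 : M%:R != 0 :> R by rewrite pnatr_eq0 -lt0n.
have : \sum_(i < M) i.+1%:R = M%:R * M.+1%:R / 2 :> R.
  by rewrite -sum_succ mulrAC divff ?mul1r.
by move=> ->; field.
Qed.

Lemma gibbsH1 : gibbsH M 1 = ln M%:R :> R.
Proof. by rewrite /gibbsH ln1 mul0r subr0 gibbsZ1. Qed.

Lemma continuous_gibbsZ : continuous (gibbsZ M : R -> R).
Proof.
apply: continuous_big => [|i _]; first exact: add_continuous.
exact: exprn_continuous.
Qed.

Lemma continuous_gibbsS : continuous (gibbsS M : R -> R).
Proof.
apply: continuous_big => [|i _ g]; first exact: add_continuous.
apply: cvgM; last exact: cvg_cst.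
exact: exprn_continuous.
Qed.

Lemma continuous_gibbsSZ g : 0 < g ->
  {for g, continuous (fun x => gibbsS M x / gibbsZ M x)}.
Proof.
move=> g0; apply: cvgM; first exact: continuous_gibbsS.
by apply: cvgV; [rewrite gt_eqF// gibbsZ_gt0|exact: continuous_gibbsZ].
Qed.

Lemma continuous_gibbsH g : 0 < g -> {for g, continuous (gibbsH M)}.
Proof.
move=> g0; apply: cvgB.
  apply: (@continuous_comp _ _ _ (gibbsZ M) (@ln R)).
    exact: continuous_gibbsZ.
  by apply: continuous_ln; rewrite gibbsZ_gt0.
by apply: cvgM; [exact: continuous_ln|exact: continuous_gibbsSZ].
Qed.

(** Quantitative decay at 0, where [ln] is not continuous. Writing [g] as a square tames the
    logarithm: [- ln g <= 2 / t], so [- ln g * g] is at most [2 * t]. *)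
Lemma gibbsH_sqr_le (t : R) : 0 < t < 1 ->
  gibbsH M (t ^+ 2) <= 3 * M%:R ^+ 2 * t.
Proof.
move=> /andP[t0 t1]; set g := t ^+ 2.
have g0 : 0 < g by rewrite exprn_gt0.
have gt : g <= t by rewrite /g expr2 ler_piMl// ltW.
have g1 : g <= 1 by rewrite (le_trans gt)// ltW.
have Zg : g <= gibbsZ M g.
  rewrite /gibbsZ; case: M M_gt0 => // m _.
  rewrite big_ord_recl expr1 lerDl; apply: sumr_ge0 => i _.
  by rewrite exprn_ge0// ltW.
have gi i : g ^+ i.+2 <= g ^+ 2.
  by rewrite -addn2 exprD ler_piMl ?exprn_ge0 ?exprn_ile1// ltW.
have Z0 := gibbsZ_gt0 M_gt0 g0.
have M1 : 1 <= M%:R :> R by rewrite ler1n.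
have Zle : gibbsZ M g <= g + M%:R * g ^+ 2.
  rewrite (_ : _ * g ^+ 2 = \sum_(i < M) g ^+ 2); last first.
    by rewrite sumr_const card_ord mulr_natl.
  rewrite /gibbsZ; case: M M_gt0 => // m _; rewrite !big_ord_recl expr1.
  rewrite lerD2l -[leLHS]add0r; apply: lerD; first by rewrite exprn_ge0// ltW.
  by apply: ler_sum => i _; exact: gi.
(* The term of index 0 cancels in the difference; the others are [i * g ^+ i.+1] with [i >= 1], each
   at most [M * g ^+ 2]. *)
have SZle : gibbsS M g - gibbsZ M g <= M%:R ^+ 2 * g ^+ 2.
  rewrite (_ : _ * g ^+ 2 = \sum_(i < M) M%:R * g ^+ 2); last first.
    by rewrite sumr_const card_ord -[RHS]mulr_natl mulrA -expr2.
  rewrite /gibbsS /gibbsZ -sumrB; apply: ler_sum => -[[|i] iM] _ /=.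
    by rewrite mulr1 subrr mulr_ge0// exprn_ge0// ltW.
  rewrite -natr1 mulrDr mulr1 addrK mulrC; apply: ler_pM => //.
    by rewrite exprn_ge0// ltW.
  by rewrite ler_nat ltnW.
have lnZ : ln (gibbsZ M g) - ln g <= M%:R * g.
  rewrite -ln_div ?posrE//.
  have := @le_ln1Dx R (gibbsZ M g / g - 1); rewrite subrKC.
  have Zg0 : 0 < gibbsZ M g / g by rewrite divr_gt0.
  move=> /(_ ltac:(lra)) /le_trans; apply.
  rewrite lerBlDr ler_pdivrMr// (le_trans Zle)// expr2; lra.
have SZ : gibbsS M g / gibbsZ M g - 1 <= M%:R ^+ 2 * g.
  rewrite -[X in _ - X](@divff _ (gibbsZ M g)) ?gt_eqF// -mulrBl.
  rewrite ler_pdivrMr// (le_trans SZle)// -[leRHS]mulrA ler_wpM2l ?exprn_ge0//.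
  by rewrite expr2 ler_pM2l.
have lng : - ln g <= 2 / t.
  rewrite /g lnXn// -mulNrn -lnV ?posrE// -[leLHS]mulr_natl ler_pM2l//.
  by rewrite ltW// ln_sublinear// invr_gt0.
have lng0 : 0 <= - ln g by rewrite oppr_ge0 ln_le0.
have M2 : M%:R <= M%:R ^+ 2 :> R by rewrite expr2 ler_peMr.
(* Splitting off [ln g] exposes two small quantities: [ln (gibbsZ M g / g)] and the excess of the
   mean over 1, both of order [g]. *)
have -> : gibbsH M g = (ln (gibbsZ M g) - ln g)
    + (- ln g) * (gibbsS M g / gibbsZ M g - 1) by rewrite /gibbsH; ring.
have h1 : M%:R * g <= M%:R ^+ 2 * t by rewrite ler_pM// ltW.
have h2 : - ln g * (gibbsS M g / gibbsZ M g - 1) <= 2 * M%:R ^+ 2 * t.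
  apply: (le_trans (ler_wpM2l lng0 SZ)).
  have Mg : 0 <= M%:R ^+ 2 * g by rewrite mulr_ge0 ?exprn_ge0// ltW.
  apply: (le_trans (ler_wpM2r Mg lng)).
  by rewrite /g [X in X <= _](_ : _ = 2 * M%:R ^+ 2 * t)//; field;
     rewrite gt_eqF.
lra.
Qed.

Lemma gibbsH_surj (h : R) : 0 < h < ln M%:R ->
  exists2 g : R, 0 < g < 1 & gibbsH M g = h.
Proof.
move=> /andP[h0 hM].
have M1 : 1 <= M%:R :> R by rewrite ler1n.
have K0 : 0 < 3 * M%:R ^+ 2 :> R by rewrite mulr_gt0// exprn_gt0// (lt_le_trans ltr01).
(* Chosen so that [t < 1] and [3 * M ^ 2 * t <= h], which makes [t ^+ 2] a left endpoint with
   entropy at most [h]. *)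
pose t := h / (3 * M%:R ^+ 2 + h).
have d0 : 0 < 3 * M%:R ^+ 2 + h by rewrite addr_gt0.
have t0 : 0 < t by rewrite divr_gt0.
have t1 : t < 1 by rewrite ltr_pdivrMr// mul1r ltrDr.
have lo : gibbsH M (t ^+ 2) <= h.
  apply: le_trans (gibbsH_sqr_le _) _; first by rewrite t0.
  by rewrite /t mulrA ler_pdivrMr// mulrC ler_pM2l// lerDl ltW.
have g0 : 0 < t ^+ 2 by rewrite exprn_gt0.
have g1 : t ^+ 2 <= 1 by rewrite exprn_ile1// ltW.
have [||c] := @IVT R (gibbsH M) (t ^+ 2) 1 h g1.
- apply: continuous_in_subspaceT => x.
  by rewrite inE /= in_itv /= => /andP[tx _]; exact/continuous_gibbsH/(lt_le_trans g0).
- by rewrite gibbsH1 ge_min lo /= le_max (ltW hM) orbT.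
rewrite in_itv /= => /andP[tc c1] Hc; exists c => //.
rewrite (lt_le_trans g0 tc) /= lt_neqAle c1 andbT.
(* The right endpoint is excluded because its entropy is [ln M], strictly above [h]. *)
by apply/eqP => ce; move: Hc; rewrite ce gibbsH1 => he; rewrite he ltxx in hM.
Qed.

(** * The hyperbolic parametrization, g = exp (- 2 mu) *)

Lemma DGcurveE (mu : R) : 0 < mu ->
  DGcurve M mu = M.+1%:R / 2 - Gcurve M (expR (- (2 * mu))).
Proof.
move=> mu0; set g := expR _.
have aux (x : R) : 0 < x -> coth x = 2 / (1 - expR (- (2 * x))) - 1.
  move=> x0; rewrite /coth /cosh /sinh.
  have -> : expR (- (2 * x)) = expR (- x) / expR x.
    by rewrite -expRN -expRD; congr expR; ring.
  have e : expR (- x) < expR x by rewrite ltr_expR gtrN.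
  field; rewrite !gt_eqF ?expR_gt0//; rewrite ?subr_gt0//.
rewrite /DGcurve !aux ?mulr_gt0 ?ltr0n//.
have -> : expR (- (2 * (M%:R * mu))) = g ^+ M.
  by rewrite /g -expRM_natl; congr expR; ring.
have g1 : g < 1 by rewrite /g -expR0 ltr_expR oppr_lt0 mulr_gt0.
have gM : g ^+ M < 1 by rewrite exprn_ilt1 ?lt0n_neq0 ?expR_ge0.
rewrite /Gcurve -natr1 -/g; field.
by rewrite !gt_eqF ?subr_gt0.
Qed.

Lemma DHcurveE (mu : R) : 0 < mu ->
  DHcurve b M mu = logb b M%:R - Hcurve b M (expR (- (2 * mu))).
Proof.
move=> mu0; rewrite /DHcurve DGcurveE//; set g := expR (- _).
rewrite /Hcurve -/(Gcurve M g) /logb expRK.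
have g0 : 0 < g by exact: expR_gt0.
have g1 : g < 1 by rewrite /g -expR0 ltr_expR oppr_lt0 mulr_gt0.
have gM : g ^+ M < 1 by rewrite exprn_ilt1 ?lt0n_neq0 ?expR_ge0.
have M0 : 0 < M%:R :> R by rewrite ltr0n.
have aux (x : R) : 0 < x -> sinh x = expR x * (1 - expR (- (2 * x))) / 2.
  move=> x0; rewrite /sinh mulrBr mulr1 -expRD; congr ((_ - expR _) / _); ring.
(* Factoring [expR x] out of each [sinh x] leaves [1 - g] and [1 - g ^+ M], the factors of the
   geometric sum. *)
have -> : M%:R * sinh mu / sinh (M%:R * mu) =
    M%:R * (expR (mu - M%:R * mu) / ((1 - g ^+ M) / (1 - g))).
  rewrite !aux ?mulr_gt0//.
  have -> : expR (- (2 * (M%:R * mu))) = g ^+ M.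
    by rewrite /g -expRM_natl; congr expR; ring.
  rewrite -/g expRD expRN; field.
  by rewrite !gt_eqF ?expR_gt0 ?subr_gt0.
have Q0 : 0 < (1 - g ^+ M) / (1 - g) by rewrite divr_gt0 ?subr_gt0.
set Q := _ / (1 - g) in Q0 *.
have EQ0 : 0 < expR (mu - M%:R * mu) / Q by rewrite divr_gt0 ?expR_gt0.
have -> : ln (M%:R * (expR (mu - M%:R * mu) / Q)) =
    ln M%:R + (mu - M%:R * mu - ln Q).
  by rewrite lnM ?posrE// ln_div ?posrE ?expR_gt0// expRK.
have -> : ln (g * Q) = ln g + ln Q by rewrite lnM ?posrE.
have -> : ln g = - (2 * mu) by rewrite /g expRK.
rewrite -natr1; field.
by rewrite gt_eqF.
Qed.

End curve.

(** * Integration of almost everywhere bounds, and measurability *)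

Section ae_probability.
Context d (T : measurableType d) (R : realType) (P : probability T R).
Implicit Types f g : T -> R.

Lemma ae_bounded_integrable f (K : R) : measurable_fun [set: T] f ->
  {ae P, forall x, `|f x| <= K} -> P.-integrable [set: T] (EFin \o f).
Proof.
move=> mf fK; apply/integrableP; split; first exact/measurable_EFinP.
apply: (@le_lt_trans _ _ (\int[P]_x (cst `|K|%:E) x)%E).
  apply: ae_ge0_le_integral => //.
  - by apply: measurableT_comp => //; exact/measurable_EFinP.
  - by move=> x _; rewrite lee_fin.
  - apply: filterS fK => x fxK _.
    by rewrite /= lee_fin (le_trans fxK)// ler_norm.
by rewrite integral_cst//= probability_setT mule1 ltry.
Qed.

Lemma ae_le_Rintegral f g : P.-integrable [set: T] (EFin \o f) ->
  P.-integrable [set: T] (EFin \o g) -> {ae P, forall x, f x <= g x} ->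
  \int[P]_x f x <= \int[P]_x g x.
Proof.
move=> fi gi fg.
have mf : measurable_fun [set: T] f.
  exact/measurable_EFinP/(measurable_int _ fi).
have mg : measurable_fun [set: T] g.
  exact/measurable_EFinP/(measurable_int _ gi).
rewrite -subr_ge0 -RintegralB//.
(* The positive part agrees almost everywhere with [g - f] and is nonnegative at every point, as
   [Rintegral_ge0] demands. *)
have -> : \int[P]_x (g x - f x) = \int[P]_x Num.max (g x - f x) 0.
  congr fine; apply: ae_eq_integral => //.
  - by apply/measurable_EFinP; exact: measurable_funB.
  - by apply/measurable_EFinP; apply: measurable_maxr => //;
       exact: measurable_funB.
  - apply: filterS fg => x fgx _; congr EFin.
    by apply/esym/max_idPl; rewrite subr_ge0.
by apply: Rintegral_ge0 => x _; rewrite le_max lexx orbT.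
Qed.

End ae_probability.

Section pmf_measurable.
Context d (T : measurableType d) (R : realType) (b : R) (M : nat).
Variable p : T -> 'I_M -> R.
Hypothesis mp : forall i, measurable_fun [set: T] (p ^~ i).

Lemma measurable_shannon : measurable_fun [set: T] (fun y => shannon b (p y)).
Proof.
apply: measurableT_comp => //; apply: measurable_sum => i.
apply: measurable_funM => //; apply: measurable_funM => //.
apply: measurableT_comp => //; exact: measurable_ln.
Qed.

Lemma measurable_guess_cost s :
  measurable_fun [set: T] (fun y => guess_cost (p y) s).
Proof. by apply: measurable_sum => i; exact: measurable_funM. Qed.

Lemma measurable_guessing : measurable_fun [set: T] (fun y => guessing (p y)).
Proof.
(* The induction runs over an arbitrary list of permutations; the default value, the cost of the
   identity, is the base case. *)
rewrite /guessing; elim: (index_enum _) => [|s r IH].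
  by under eq_fun do rewrite big_nil; exact: measurable_guess_cost.
under eq_fun do rewrite big_cons.
by apply: measurable_minr => //; exact: measurable_guess_cost.
Qed.

End pmf_measurable.

(** * Conditional pmfs and averaging over the side information *)

Section cond.
Local Open Scope charge_scope.
Context (R : realType) (b : R) (M : nat) d (Omega : measurableType d)
  (P : probability Omega R) d' (T : measurableType d')
  (X : {RV P >-> nat}) (Y : {RV P >-> T}).
Hypotheses (b_gt1 : 1 < b) (XM : forall w, (1 <= X w <= M)%N).

Let PY := distribution P Y.

Let mX n : measurable (X @^-1` [set n]).
Proof. by rewrite -[_ @^-1` _]setTI; exact: measurable_funPT. Qed.

Let mY B : measurable B -> measurable (Y @^-1` B).
Proof. by move=> mB; rewrite -[_ @^-1` _]setTI; exact: measurable_funPT. Qed.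

Lemma joint_dominates n : joint X Y n `<< PY.
Proof.
apply/null_content_dominatesP => A mA PA0.
apply/eqP; rewrite eq_le measure_ge0 andbT -PA0.
apply: le_measure; rewrite ?inE; [|exact: mY|exact: subIsetl].
by apply: measurableI => //; exact: mY.
Qed.

(** The events [X = i.+1] for [i < M] partition the sample space, because [X] takes values in 1,
    ..., M at every point. *)
Lemma joint_sum B : measurable B -> (\sum_(i < M) joint X Y i.+1 B = PY B)%E.
Proof.
move=> mB; rewrite /joint -(@measure_semi_additive_ord _ _ _ P M
  (fun i => Y @^-1` B `&` X @^-1` [set i.+1])).
- congr (P _); rewrite -(bigcup_mkord M (fun i => Y @^-1` B `&` X @^-1` [set i.+1])).
  apply/seteqP; split=> w /=; first by move=> [i _ []].
  move=> Bw; have := XM w; case Xn : (X w) => [|n] // nM.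
  by exists n.
- by move=> i; apply: measurableI => //; exact: mY.
- by move=> i j _ _ [w [[_ /= ->] [_ /= [] /val_inj]]].
- by apply: bigsetU_measurable => i _; apply: measurableI => //; exact: mY.
Qed.

Let dens n := 'd (charge_of_finite_measure (joint X Y n)) '/d PY.

Let cond_pmfE y (i : 'I_M) : (cond_pmf X Y y i)%:E = dens i.+1 y.
Proof.
by rewrite /cond_pmf fineK//; apply: Radon_Nikodym_fin_num; exact: joint_dominates.
Qed.

Lemma measurable_cond_pmf i :
  measurable_fun [set: T] (fun y => @cond_pmf _ M _ _ _ _ _ X Y y i).
Proof.
apply/measurable_EFinP; rewrite (_ : _ \o _ = dens i.+1); last first.
  by apply/funext => y /=; exact: cond_pmfE.
by apply: measurable_int (Radon_Nikodym_integrable _); exact: joint_dominates.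
Qed.

Lemma cond_pmf_ge0 :
  {ae PY, forall y, forall i, 0 <= @cond_pmf _ M _ _ _ _ _ X Y y i}.
Proof.
(* The derivative used in [cond_pmf] is that of a charge, hence of no prescribed sign; it agrees
   almost everywhere with the nonnegative derivative of a measure. *)
have h : {ae PY, forall y, forall n, (0 <= dens n y)%E}.
  apply: ae_foralln => n.
  have := @ae_eq_Radon_Nikodym_SigmaFinite _ _ _ (joint X Y n) PY
    (joint_dominates n) setT measurableT.
  apply: filterS => y /(_ I) E; rewrite /dens -E.
  exact/Radon_Nikodym_SigmaFinite.f_ge0/joint_dominates.
by apply: filterS h => y h i; rewrite -lee_fin cond_pmfE.
Qed.

Lemma cond_pmf_sum :
  {ae PY, forall y, \sum_i @cond_pmf _ M _ _ _ _ _ X Y y i = 1}.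
Proof.
have intd n : PY.-integrable [set: T] (dens n).
  by apply: Radon_Nikodym_integrable; exact: joint_dominates.
(* Both sides have the same integral over every measurable [E]: the densities integrate to [joint],
   and these sum to [PY E]. *)
have h : ae_eq PY [set: T] (fun y => \sum_(i < M) dens i.+1 y)%E (cst 1%E).
  apply: integral_ae_eq => //.
    by apply: integrable_sum => // i _; exact: intd.
  move=> E _ mE; rewrite integral_cst// mul1e integral_sum//.
    rewrite -[RHS]joint_sum//; apply: eq_bigr => i _.
    by rewrite -Radon_Nikodym_integral//; exact: joint_dominates.
  by move=> i; apply: integrableS (intd _).
apply: filterS h => y /(_ I) /= h; apply: EFin_inj.
by rewrite -sumEFin -h; apply: eq_bigr => i _; rewrite cond_pmfE.
Qed.

Lemma ae_cond_pmf : {ae PY, forall y,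
  (forall i, 0 <= @cond_pmf _ M _ _ _ _ _ X Y y i) /\
  \sum_i @cond_pmf _ M _ _ _ _ _ X Y y i = 1}.
Proof. exact: filterI cond_pmf_ge0 cond_pmf_sum. Qed.

Lemma cond_shannon_le (g : R) : (0 < M)%N -> 0 < g ->
  cond_shannon b M X Y * ln b <=
    ln (gibbsZ M g) - ln g * cond_guessing M X Y.
Proof.
move=> M0 g0; rewrite /cond_shannon /cond_guessing unlock.
pose f y := shannon b (@cond_pmf R M _ _ P _ _ X Y y).
pose h y := guessing (@cond_pmf R M _ _ P _ _ X Y y).
have fi : PY.-integrable [set: T] (EFin \o f).
  apply: (@ae_bounded_integrable _ _ _ PY f (M%:R / ln b)).
    exact/measurable_shannon/measurable_cond_pmf.
  by apply: filterS ae_cond_pmf => y [p0 p1]; exact: norm_shannon_le.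
have hi : PY.-integrable [set: T] (EFin \o h).
  apply: (@ae_bounded_integrable _ _ _ PY h (\sum_(i < M) i.+1%:R)).
    exact/measurable_guessing/measurable_cond_pmf.
  by apply: filterS ae_cond_pmf => y [p0 p1]; exact: norm_guessing_le.
change (\int[PY]_y f y * ln b <= ln (gibbsZ M g) - ln g * \int[PY]_y h y).
have ci (c : R) : PY.-integrable [set: T] (EFin \o cst c).
  exact: finite_measure_integrable_cst.
have Zi : PY.-integrable [set: T] (EFin \o (fun y => ln g * h y)).
  exact: (integrableZl measurableT (ln g) hi).
rewrite mulrC -RintegralZl//.
(* The constant is written as an integral over a probability measure, so that the pointwise
   inequality can be integrated as a whole. *)
rewrite -[X in X - _](_ : \int[PY]_y cst (ln (gibbsZ M g)) y = _); last first.
  by rewrite Rintegral_cst//= probability_setT mulr1.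
rewrite -RintegralZl// -RintegralB//.
apply: ae_le_Rintegral.
- exact: (integrableZl measurableT (ln b) fi).
- exact: integrableB (ci _) Zi.
- apply: filterS ae_cond_pmf => y [p0 p1] /=.
  by rewrite mulrC; exact: shannon_le_guessing.
Qed.

End cond.

(** * Attainment: constant side information and prescribed pmfs *)

Section trivial_side_information.
Local Open Scope charge_scope.
Context (R : realType) (b : R) (M : nat) d (Omega : measurableType d)
  (P : probability Omega R) (X : {RV P >-> nat}).

Let Y : {RV P >-> unit} := cst tt.

(** The one point of [unit] has mass 1, so the density there equals its own integral, which is P(X =
    i.+1). The equality thus holds everywhere. *)
Lemma cond_pmf_unit y : cond_pmf X Y y = pmf_of X :> ('I_M -> R).
Proof.
apply/funext => i; rewrite /cond_pmf /pmf_of; congr fine.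
set f := Radon_Nikodym _ _.
have -> : P (X @^-1` [set i.+1]) = joint X Y i.+1 setT.
  by rewrite /joint preimage_setT setTI.
have dom : joint X Y i.+1 `<< distribution P Y by exact: joint_dominates.
have -> : joint X Y i.+1 setT = (\int[distribution P Y]_x f x)%E.
  exact: (Radon_Nikodym_integral (nu := charge_of_finite_measure _) dom).
rewrite (_ : f = cst (f y)); last by apply/funext => -[]; case: y.
by rewrite integral_cst// [X in (_ * X)%E]probability_setT mule1.
Qed.

Lemma cond_shannon_unit : cond_shannon b M X Y = shannon b (pmf_of (M := M) X).
Proof.
rewrite /cond_shannon (_ : (fun y => _) = cst (shannon b (pmf_of (M := M) X))).
  by rewrite expectation_cst.
by apply/funext => y /=; rewrite cond_pmf_unit.
Qed.

Lemma cond_guessing_unit : cond_guessing M X Y = guessing (pmf_of (M := M) X).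
Proof.
rewrite /cond_guessing (_ : (fun y => _) = cst (guessing (pmf_of (M := M) X))).
  by rewrite expectation_cst.
by apply/funext => y /=; rewrite cond_pmf_unit.
Qed.

End trivial_side_information.

(** Shifts an index to the value it stands for, and truncates so that the range is within 1, ..., M
    at every point, even outside the support of the measure. *)
Definition clamp (M n : nat) : nat := (minn n M.-1).+1.

Lemma measurable_clamp M : measurable_fun [set: nat] (clamp M).
Proof. by []. Qed.

HB.instance Definition _ M :=
  isMeasurableFun.Build _ _ nat nat (clamp M) (@measurable_clamp M).

Lemma exists_pmf (R : realType) (M : nat) (q : nat -> R) :
  (0 < M)%N -> (forall n, 0 <= q n) -> \sum_(i < M) q i = 1 ->
  exists (P : probability nat R) (X : {RV P >-> nat}),
    (forall w, (1 <= X w <= M)%N) /\ forall i : 'I_M, pmf_of X i = q i.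
Proof.
move=> M0 q0 q1.
pose mu : {measure set nat -> \bar R} :=
  msum (fun n => mscale (NngNum (q0 n)) (@dirac _ nat n R)) M.
have muE A : mu A = (\sum_(i < M) (q i * \1_A (i : nat)))%:E.
  rewrite /mu /= /msum -sumEFin; apply: eq_bigr => i _.
  by rewrite /mscale /dirac EFinM.
have muT : mu [set: nat] = 1%E.
  by rewrite muE -[in RHS]q1; congr EFin;
    apply: eq_bigr => i _; rewrite indicT mulr1.
(* [mnormalize] serves to obtain a probability; the total mass is already 1, so it changes nothing
   and its fallback Dirac mass does not occur. *)
have normE A : mnormalize mu (@dirac _ nat 0%N R) A = mu A.
  by rewrite /mnormalize muT onee_eq0 /= invr1 mule1.
exists (mnormalize mu (@dirac _ nat 0%N R)), (clamp M); split=> [w|i].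
  by rewrite /= /clamp /= -[leqRHS](prednK M0) ltnS geq_minr.
rewrite /pmf_of /= normE muE /=.
rewrite (bigD1 i)//= big1 ?addr0.
  rewrite indicE mem_set ?mulr1//= /clamp; congr _.+1; apply/minn_idPl.
  by rewrite -ltnS prednK.
move=> j ji; rewrite indicE memNset ?mulr0//= /clamp => -[] ij.
move/eqP: ji; apply; apply/val_inj => /=; rewrite -ij; apply/esym/minn_idPl.
by rewrite -ltnS prednK.
Qed.

Lemma exists_gibbs (R : realType) (b : R) (M : nat) (g : R) :
  1 < b -> (0 < M)%N -> 0 < g <= 1 ->
  exists (d : measure_display) (Omega : measurableType d)
    (P : probability Omega R) (d' : measure_display)
    (T : measurableType d') (X : {RV P >-> nat}) (Y : {RV P >-> T}),
    [/\ (forall w, (1 <= X w <= M)%N),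
        forall i : 'I_M, pmf_of X i = gibbs M g i,
        cond_shannon b M X Y = gibbsH M g / ln b &
        cond_guessing M X Y = gibbsS M g / gibbsZ M g].
Proof.
move=> b1 M0 /[dup] g01 /andP[g0 _].
have q0 n : 0 <= gibbs M g n by rewrite ltW// gibbs_gt0.
have [P [X [XM Xq]]] := exists_pmf M0 q0 (sum_gibbs M0 g0).
exists _, _, P, _, unit, X, (cst tt).
have e : pmf_of X = (fun i : 'I_M => gibbs M g i) by apply/funext.
split=> //.
- by rewrite cond_shannon_unit e shannon_gibbs.
- by rewrite cond_guessing_unit e guessing_gibbs.
Qed.

(** * Optimality of both curves *)

Theorem theorem1 (R : realType) (b : R) (hb : 1 < b) (M : nat)
    (hM : (2 <= M)%N) :
  (* (1) *)
  ([/\ (forall (d : measure_display) (Omega : measurableType d)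
          (P : probability Omega R) (d' : measure_display)
          (T : measurableType d') (X : {RV P >-> nat}) (Y : {RV P >-> T}),
          (forall w, (1 <= X w <= M)%N) ->
          forall g : R, 0 < g < 1 ->
          cond_shannon b M X Y = Hcurve b M g ->
          Gcurve M g <= cond_guessing M X Y),
       (forall g : R, 0 < g < 1 ->
          exists (d : measure_display) (Omega : measurableType d)
            (P : probability Omega R) (d' : measure_display)
            (T : measurableType d') (X : {RV P >-> nat}) (Y : {RV P >-> T}),
            [/\ (forall w, (1 <= X w <= M)%N),
                cond_shannon b M X Y = Hcurve b M g &
                cond_guessing M X Y = Gcurve M g]) &
       (forall h : R, 0 < h < logb b M%:R ->
          exists2 g : R, 0 < g < 1 & Hcurve b M g = h)] /\
   (* the limiting case g -> 1 *)
   [/\ Gcurve M g @[g --> (1 : R)^'-] --> (M.+1%:R / 2 : R),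
       Hcurve b M g @[g --> (1 : R)^'-] --> logb b (M%:R : R),
       (forall (d : measure_display) (Omega : measurableType d)
          (P : probability Omega R) (X : {RV P >-> nat}),
          (forall w, (1 <= X w <= M)%N) ->
          (forall i : 'I_M, pmf_of X i = M%:R^-1) ->
          shannon b (pmf_of (M := M) X) = logb b M%:R /\
          guessing (pmf_of (M := M) X) = M.+1%:R / 2) &
       (exists (d : measure_display) (Omega : measurableType d)
          (P : probability Omega R) (d' : measure_display)
          (T : measurableType d') (X : {RV P >-> nat}) (Y : {RV P >-> T}),
          [/\ (forall w, (1 <= X w <= M)%N),
              (forall i : 'I_M, pmf_of X i = M%:R^-1),
              cond_shannon b M X Y = logb b M%:R &
              cond_guessing M X Y = M.+1%:R / 2])]) /\
  (* (2) *)
  [/\ (forall (d : measure_display) (Omega : measurableType d)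
         (P : probability Omega R) (d' : measure_display)
         (T : measurableType d') (X : {RV P >-> nat}) (Y : {RV P >-> T}),
         (forall w, (1 <= X w <= M)%N) ->
         forall mu : R, 0 < mu ->
         DeltaH b M X Y = DHcurve b M mu ->
         DeltaG M X Y <= DGcurve M mu),
      (forall mu : R, 0 < mu ->
         exists (d : measure_display) (Omega : measurableType d)
           (P : probability Omega R) (d' : measure_display)
           (T : measurableType d') (X : {RV P >-> nat}) (Y : {RV P >-> T}),
           [/\ (forall w, (1 <= X w <= M)%N),
               DeltaH b M X Y = DHcurve b M mu &
               DeltaG M X Y = DGcurve M mu]) &
      (forall h : R, 0 < h < logb b M%:R ->
         exists2 mu : R, 0 < mu & DHcurve b M mu = h)].
Proof.
have M0 : (0 < M)%N := ltnW hM.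
have lnb0 : 0 < ln b by exact: ln_gt0.
have G_opt d (Omega : measurableType d) (P : probability Omega R) d'
    (T : measurableType d') (X : {RV P >-> nat}) (Y : {RV P >-> T}) :
    (forall w, (1 <= X w <= M)%N) -> forall g : R, 0 < g < 1 ->
    cond_shannon b M X Y = Hcurve b M g -> Gcurve M g <= cond_guessing M X Y.
  move=> XM g /[dup] g01 /andP[g0 g1] HX.
  (* The entropy on the curve is the equality case, so [ln (gibbsZ M g)] cancels and the negative
     factor [ln g] reverses the order. *)
  have := cond_shannon_le Y hb XM M0 g0.
  rewrite HX HcurveE// divfK ?gt_eqF// /gibbsH -GcurveE//.
  by rewrite lerD2l lerN2 ler_nM2l// ln_lt0.
have G_att (g : R) : 0 < g < 1 ->
    exists (d : measure_display) (Omega : measurableType d)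
      (P : probability Omega R) (d' : measure_display)
      (T : measurableType d') (X : {RV P >-> nat}) (Y : {RV P >-> T}),
      [/\ (forall w, (1 <= X w <= M)%N), cond_shannon b M X Y = Hcurve b M g &
          cond_guessing M X Y = Gcurve M g].
  move=> /[dup] g01 /andP[g0 g1].
  have g0le1 : 0 < g <= 1 by rewrite g0 ltW.
  have [d0 [W [P [d1 [T [X [Y [XM _ HX GX]]]]]]]] := exists_gibbs hb M0 g0le1.
  by exists d0, W, P, d1, T, X, Y; split; rewrite ?HcurveE ?GcurveE.
have H_surj (h : R) : 0 < h < logb b M%:R ->
    exists2 g : R, 0 < g < 1 & Hcurve b M g = h.
  move=> /andP[h0 hM'].
  have [|g g01 gh] := @gibbsH_surj R M M0 (h * ln b).
    by rewrite mulr_gt0//= -ltr_pdivlMr.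
  by exists g => //; rewrite HcurveE// gh mulfK// gt_eqF.
have expmu (mu : R) : 0 < mu -> 0 < expR (- (2 * mu)) < 1.
  by move=> mu0; rewrite expR_gt0 -[X in _ < X]expR0 ltr_expR oppr_lt0 mulr_gt0.
have near01 : \forall g \near (1 : R)^'-, 0 < g < 1.
  near=> g; apply/andP; split; last by near: g; exact: nbhs_left_lt.
  by near: g; exact: nbhs_left_gt.
split; split.
- split=> //; exact: G_opt.
- split.
  (* The closed form divides by zero at [g = 1]; on the left of 1 it coincides with a quotient of
     sums continuous there. *)
  + rewrite -(gibbsSZ1 R M0).
    apply: cvg_trans (cvg_at_left_filter (continuous_gibbsSZ M0 ltr01)).
    apply: near_eq_cvg; apply: filterS near01 => g g01; by rewrite GcurveE.
  + have -> : logb b M%:R = gibbsH M 1 / ln b by rewrite gibbsH1.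
    have c : {for 1, continuous (fun g => gibbsH M g / ln b)}.
      by apply: cvgM; [exact: continuous_gibbsH|exact: cvg_cst].
    apply: cvg_trans (cvg_at_left_filter c).
    apply: near_eq_cvg; apply: filterS near01 => g g01; by rewrite HcurveE.
  + move=> d Omega P X _ Xu.
    have -> : pmf_of X = (fun i : 'I_M => gibbs M 1 i).
      by apply/funext => i; rewrite Xu /gibbs expr1n gibbsZ1 mul1r.
    rewrite shannon_gibbs// guessing_gibbs ?lexx ?ltr01//.
    by rewrite gibbsH1 (gibbsSZ1 R M0).
  + have one01 : 0 < (1 : R) <= 1 by rewrite ltr01 lexx.
    have [d0 [W [P [d1 [T [X [Y [XM Xu HX GX]]]]]]]] := exists_gibbs hb M0 one01.
    exists d0, W, P, d1, T, X, Y; split => //.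
    * by move=> i; rewrite Xu /gibbs expr1n gibbsZ1 mul1r.
    * by rewrite HX (gibbsH1 R M).
    * by rewrite GX (gibbsSZ1 R M0).
(* Both gaps are measured from the same constants as the curve, which cancel and leave part (1) with
   the order reversed. *)
- move=> d Omega P d' T X Y XM mu mu0.
  rewrite /DeltaH /DeltaG DHcurveE// DGcurveE// => /addrI/oppr_inj HX.
  by rewrite lerD2l lerN2; apply: G_opt => //; exact: expmu.
- move=> mu mu0.
  have [d0 [W [P [d1 [T [X [Y [XM HX GX]]]]]]]] := G_att _ (expmu _ mu0).
  exists d0, W, P, d1, T, X, Y; split => //.
  + by rewrite /DeltaH HX DHcurveE.
  + by rewrite /DeltaG GX DGcurveE.
- move=> h /andP[h0 hM'].
  have [|g /andP[g0 g1] gh] := H_surj (logb b M%:R - h).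
    by rewrite subr_gt0 hM' ltrBlDr ltrDl.
  (* This [mu] solves [expR (- (2 * mu)) = g]. *)
  have mu0 : 0 < - ln g / 2 by rewrite divr_gt0// oppr_gt0 ln_lt0// g0.
  exists (- ln g / 2) => //; rewrite DHcurveE//.
  have -> : - (2 * (- ln g / 2)) = ln g by rewrite mulrCA divff// mulr1 opprK.
  by rewrite lnK ?posrE// gh opprB addrC subrK.
Unshelve. all: by end_near. Qed.
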